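(* Let $c\in\mathbb C$ and let $f:\mathbb R^3\dashrightarrow\mathbb R$ be a real rational solution of the eikonal equation $E(f)=c^2$. Then $f$ is an affine function.
   Context: For a function $f$ of $(z_1,z_2,z_3)$, $E(f)=\sum_{i=1}^3\left(\frac{\partial f}{\partial z_i}\right)^2$. The equation $E(f)=c^2$, with $c$ a constant, is called the eikonal equation. *)

(* Defs.v *)
From HB Require Import structures.
From mathcomp Require Import all_boot all_order all_algebra.
From mathcomp Require Import generic_quotient ring.
From mathcomp Require Import reals complex.
From mathcomp Require Import mpoly.

Set Implicit Arguments.
Unset Strict Implicit.
Unset Printing Implicit Defensive.

Import GRing.Theory.
Local Open Scope ring_scope.
Local Open Scope quotient_scope.

(* A rational function K^n --> K is an element of K(z_1, ..., z_n), the
   fraction field of the polynomial ring. *)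
Notation ratfun K n := {fraction {mpoly K[n]}}.

Section FractionRepresentatives.
Variable D : idomainType.

Definition fnum (f : {fraction D}) : D := \n_(repr f).
Definition fden (f : {fraction D}) : D := \d_(repr f).

Lemma fden_neq0 (f : {fraction D}) : fden f != 0.
Proof. exact: denom_ratioP. Qed.

Lemma fracE (f : {fraction D}) : f = tofrac (fnum f) / tofrac (fden f).
Proof.
have dn0 : tofrac (fden f) != 0 by rewrite tofrac_eq0 fden_neq0.
apply: (canRL (mulfK dn0)).
rewrite -{1}(reprK f) /fnum /fden; move: (repr f) => x.
unlock tofrac; rewrite -[LHS]FracField.pi_mul; apply/eqmodP.
rewrite /= FracField.equivfE /FracField.mulf.
rewrite !numden_Ratio ?mulf_neq0 ?oner_neq0 ?denom_ratioP //.
by apply/eqP; ring.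
Qed.

Lemma frac_eqP (p q r s : D) : q != 0 -> s != 0 ->
  (tofrac p / tofrac q = tofrac r / tofrac s) <-> p * s = r * q.
Proof.
move=> q0 s0; split=> [/eqP|e].
  by rewrite eqr_div ?tofrac_eq0 // -!tofracM tofrac_eq => /eqP.
by apply/eqP; rewrite eqr_div ?tofrac_eq0 // -!tofracM e.
Qed.

Lemma fnum_fden (p q : D) : q != 0 ->
  let f := tofrac p / tofrac q in fnum f * q = p * fden f.
Proof. by move=> q0 f; apply/frac_eqP; rewrite ?fden_neq0 // -fracE. Qed.

End FractionRepresentatives.

Section Derivative.
Variables (K : fieldType) (n : nat).
Implicit Types (f : ratfun K n) (p q : {mpoly K[n]}).

(* The quotient rule; rderiv_frac shows that the fraction chosen to represent
   f is irrelevant. *)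
Definition rderiv (i : 'I_n) f : ratfun K n :=
  tofrac ((fnum f)^`M(i) * fden f - fnum f * (fden f)^`M(i))
    / tofrac (fden f ^+ 2).

Lemma rderiv_frac (i : 'I_n) p q : q != 0 ->
  rderiv i (tofrac p / tofrac q)
    = tofrac (p^`M(i) * q - p * q^`M(i)) / tofrac (q ^+ 2).
Proof.
move=> q0; have d0 := fden_neq0 (tofrac p / tofrac q).
have := fnum_fden p q0; rewrite /rderiv /=.
set a := fnum _; set b := fden _ in d0 * => e.
apply/frac_eqP; rewrite ?expf_neq0 //.
have /(congr1 (mderiv i)) := e; rewrite !mderivM => de.
pose a' := a^`M(i); pose b' := b^`M(i); pose p' := p^`M(i); pose q' := q^`M(i).
rewrite -/a' -/b' -/p' -/q' in de *.
have -> : (a' * b - a * b') * q ^+ 2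
  = b * q * (a' * q + a * q') - b * q' * (a * q) - b' * q * (a * q) by ring.
by rewrite de e; ring.
Qed.

End Derivative.

Definition eikonal (K : fieldType) (f : ratfun K 3) : ratfun K 3 :=
  \sum_(i < 3) rderiv i f ^+ 2.

Definition ratfunC (K : fieldType) (n : nat) (c : K) : ratfun K n :=
  tofrac c%:MP.

Section ChangeOfField.
Variables (K L : fieldType) (n : nat) (phi : {rmorphism K -> L}).

(* The field embedding K(z_1, ..., z_n) -> L(z_1, ..., z_n) extending phi. *)
Definition ratfun_map (f : ratfun K n) : ratfun L n :=
  tofrac (map_mpoly phi (fnum f)) / tofrac (map_mpoly phi (fden f)).

Lemma map_mpoly_eq0 (p : {mpoly K[n]}) : (map_mpoly phi p == 0) = (p == 0).
Proof.
apply/eqP/eqP => [p0|->]; last by rewrite raddf0.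
apply/mpolyP => m; have /(congr1 (mcoeff m)) := p0.
by rewrite mcoeff_map_mpoly !mcoeff0 => /eqP; rewrite fmorph_eq0 => /eqP.
Qed.

Lemma ratfun_map_frac (p q : {mpoly K[n]}) : q != 0 ->
  ratfun_map (tofrac p / tofrac q)
    = tofrac (map_mpoly phi p) / tofrac (map_mpoly phi q).
Proof.
move=> q0; have := fnum_fden p q0; rewrite /ratfun_map /=.
have := fden_neq0 (tofrac p / tofrac q).
move: (fnum _) (fden _) => a b b0 e.
by apply/frac_eqP; rewrite ?map_mpoly_eq0 // -!rmorphM e.
Qed.

End ChangeOfField.

(* The inclusion of R(z_1, ..., z_n) in C(z_1, ..., z_n). *)
Definition ratfun_complex (R : realType) (n : nat) (f : ratfun R n) :
  ratfun R[i] n := ratfun_map (real_complex R) f.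

Definition is_affine (K : fieldType) (n : nat) (f : ratfun K n) : Prop :=
  exists (a : 'I_n -> K) (b : K),
    f = tofrac (\sum_(i < n) a i *: 'X_i + b%:MP).

(* Main.v *)
Require Import Defs.
From mathcomp Require Import all_boot all_order all_algebra.
From mathcomp Require Import ring lra.
From mathcomp Require Import reals complex polyrcf.
From mathcomp Require Import mpoly.
From mathcomp Require boolp.

Set Implicit Arguments.
Unset Strict Implicit.
Unset Printing Implicit Defensive.

Import Order.TTheory GRing.Theory Num.Theory.
Local Open Scope ring_scope.

(** Write [f = p / q] with gradient [v = grad f]; the equation says that
    [|v|^2] is a real constant [c >= 0].

    Every straight line on which [q] does not vanish identically turns [f] into
    a rational function of one variable whose slope is bounded by
    [sqrt c] times the speed of the line.  A rational function of bounded slope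
    has no real pole, so the mean value theorem applies on the whole line, and
    [f] is globally Lipschitz:
    [(f x - f y)^2 <= c |x - y|^2] ([eikonal_lipschitz]).

    On the other hand the characteristics of the eikonal equation are lines: as
    the Hessian of [f] is symmetric and kills [v], the gradient is
    constant along the line [x + t v(x)], and there [f = f(x) + c t] for all
    real [t] ([grad_characteristic], [fun_characteristic]).

    The two facts together are rigid.  Comparing an arbitrary point [y] with
    [x + t v] gives [(f y - f x - c t)^2 <= c |y - x - t v|^2]; the terms in
    [t^2] cancel, what remains is an affine function of [t] that keeps its
    sign on the whole real line, so its slope is zero.  For [c > 0] this says
    [f y = f x + v . (y - x)], and for [c = 0] the inequality itself says
    [f y = f x] ([eikonal_polynomial_affine]).

    Reality enters through the order: neither the Lipschitz bound nor the sign
    argument has a complex counterpart.  All steps are carried out on the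
    polynomials [p] and [q], with denominators cleared, so that they make sense
    over any real closed field and in any dimension. *)

(** * Rational functions of one variable with bounded slope *)

(** The numerator of [(P / Q)'] over the denominator [Q ^+ 2]. *)
Definition wronskian (K : nzRingType) (P Q : {poly K}) : {poly K} :=
  P^`() * Q - P * Q^`().

Section Wronskian.
Variable K : comNzRingType.
Implicit Types (P Q u : {poly K}) (a : K).

Lemma wronskian_mulXsubC a n u Q :
  wronskian (u * ('X - a%:P) ^+ n.+1) Q
    = (u * Q *+ n.+1 + ('X - a%:P) * wronskian u Q) * ('X - a%:P) ^+ n.
Proof.
rewrite /wronskian derivM deriv_exp derivXsubC mul1r /= exprS -mulr_natr.
by rewrite -[_ *+ n.+1 in RHS]mulr_natr; ring.
Qed.

Lemma wronskianN P Q : wronskian P Q = - wronskian Q P.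
Proof. by rewrite /wronskian; ring. Qed.

Lemma wronskian_mulr u P Q :
  wronskian (P * u) (Q * u) = wronskian P Q * u ^+ 2.
Proof. by rewrite /wronskian !derivM; ring. Qed.

End Wronskian.

Section BoundedSlope.
Variable R : rcfType.
Implicit Types (A B P Q S : {poly R}).

(** An inequality between polynomials may be checked away from the finitely many
    zeros of [B], by continuity; this is how denominators get cancelled. *)
Lemma poly_ge0_dense A B : B != 0 ->
  (forall x, 0 <= B.[x] ^+ 2 * A.[x]) -> forall x, 0 <= A.[x].
Proof.
move=> B0 hBA x; rewrite leNgt; apply/negP => Ax.
have [|d d0 hd] := @poly_cont _ x A (- A.[x]); first by rewrite oppr_gt0.
have xd : x < x + d by rewrite ltrDl.
have [y yB] := neighpr_wit xd B0.
have By := neighpr_root yB.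
have /andP[xy yd] : (x < y) && (y < x + d).
  have := @next_root_in _ B x (x + d); move: yB; rewrite !in_itv /=.
  move=> /andP[-> yn] /andP[_]; rewrite max_l ?lerDl ?(ltW d0) //.
  exact: lt_le_trans.
have Ay : A.[y] < 0.
  have := hd y; rewrite ger0_norm ?subr_ge0 ?(ltW xy) // ltrBlDl => /(_ yd).
  by move=> /(le_lt_trans (ler_norm _)); rewrite ltrBlDr addNr.
have := hBA y; rewrite leNgt; apply/negP/negPn.
by rewrite pmulr_rlt0 // lt0r sqrf_eq0 sqr_ge0 andbT.
Qed.

(** Rolle's theorem for [S / Q].  Between consecutive roots [a] and [b] of [S],
    dividing the wronskian by its powers of [X - a] and [X - b] leaves a
    polynomial of opposite signs at [a] and [b]. *)
Lemma rational_rolle S Q a b : a < b ->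
    (forall x, a <= x <= b -> Q.[x] != 0) -> S.[a] = 0 -> S.[b] = 0 ->
  exists2 x, a < x < b & (wronskian S Q).[x] = 0.
Proof.
move=> ab Q0 Sa Sb.
have [->|S0] := eqVneq S 0.
  exists ((a + b) / 2%:R); first lra.
  by rewrite /wronskian derivC !mul0r subrr horner0.
(* It is enough to treat a and the next root of S. *)
wlog Snr : b ab Q0 Sb / {in `]a, b[, forall x, ~~ root S x}.
  move=> hw; have := @next_rootP _ S a b; case.
  - by move=> S00; rewrite S00 eqxx in S0.
  - move=> y _ Sy; rewrite in_itv /= => /andP[ay yb] Snr.
    have [|//|//|x /andP[ax xy] Wx] := hw y ay.
      by move=> z /andP[az zy]; apply: Q0; rewrite az (le_trans zy) ?ltW.
    by exists x => //; rewrite ax (lt_trans xy).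
  - by move=> c _ _ Snr; exact: hw.
have [n [u]] := multiplicity_XsubC S a; rewrite S0 /= => ua Su.
have [m [T]] := multiplicity_XsubC u b.
have u0 : u != 0 by apply: contraNneq S0 => u0; rewrite Su u0 mul0r.
rewrite u0 /= => Tb uT.
have Ta : ~~ root T a.
  by apply: contraNN ua => /rootP Ta; rewrite /root uT hornerM Ta mul0r.
case: n Su => [|n] Su.
  case/negP: ua; rewrite -[u]mulr1 -(expr0 ('X - a%:P)) -Su.
  exact/rootP.
case: m uT => [|m] uT.
  have := Sb; rewrite Su uT expr0 mulr1 hornerM horner_exp hornerXsubC => /eqP.
  by rewrite mulf_eq0 -rootE (negPf Tb) /= expf_eq0 subr_eq0 (gt_eqF ab) andbF.
have TQ : 0 < (T * Q).[a] * (T * Q).[b].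
  have TQa : (T * Q).[a] != 0 by rewrite hornerM mulf_neq0 // Q0 // lexx ltW.
  have TQb : (T * Q).[b] != 0 by rewrite hornerM mulf_neq0 // Q0 // lexx ltW.
  rewrite lt0r mulf_neq0 //= leNgt; apply/negP => /poly_ivtoo [|x xab].
    exact: ltW.
  rewrite rootM => /orP[Tx|/rootP Qx].
    have := Snr x xab; rewrite Su uT /root !hornerM.
    by move/rootP: Tx => ->; rewrite !mul0r eqxx.
  move: xab; rewrite in_itv /= => /andP[/ltW ax /ltW xb].
  by have := Q0 x; rewrite ax xb Qx eqxx => /(_ isT).
(* What remains of the wronskian without its zeros at a and b. *)
pose r := T * Q *+ n.+1 * ('X - b%:P)
  + ('X - a%:P) * (T * Q *+ m.+1 + ('X - b%:P) * wronskian T Q).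
have Wr : wronskian S Q = r * ('X - b%:P) ^+ m * ('X - a%:P) ^+ n.
  rewrite Su wronskian_mulXsubC uT wronskian_mulXsubC /r exprS.
  move: (wronskian T Q) ('X - a%:P) ('X - b%:P) => w xa xb.
  rewrite -(mulr_natr (T * _ * Q)) -(mulr_natr (T * Q) n.+1).
  move: (T * Q *+ m.+1) (xa ^+ n) (xb ^+ m) (n.+1%:R) => tq xan xbm k.
  by ring.
have [||x] := @poly_ivtoo _ r a b; first exact: ltW.
  rewrite /r; move: (T * Q) (wronskian T Q) TQ => p w TQ.
  rewrite !(hornerXsubC, hornerD, hornerM, hornerMn) !subrr.
  rewrite !(mul0r, mulr0, addr0, add0r) -!(mulr_natr _.[_]).
  rewrite [X in X < 0](_ : _ =
    - (p.[a] * p.[b] * ((b - a) ^+ 2 * n.+1%:R * m.+1%:R))).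
    by rewrite oppr_lt0 mulr_gt0 // !mulr_gt0 ?ltr0n ?subr_gt0.
  by move: n.+1%:R m.+1%:R => k l; ring.
rewrite in_itv /= => xab /rootP rx; exists x => //.
by rewrite Wr !hornerM rx !mul0r.
Qed.

(** A pole of order [m > 0] of [P / Q] would be a pole of order [m + 1] of the
    derivative, which is bounded; so [P] vanishes too. *)
Lemma root_of_bounded_slope P Q C r : Q != 0 ->
    (forall x, (wronskian P Q).[x] ^+ 2 <= C * Q.[x] ^+ 4) ->
  root Q r -> root P r.
Proof.
move=> Q0 hW Qr; have [m [u]] := multiplicity_XsubC Q r.
rewrite Q0 /= => ur Qu; case: m Qu => [|m] Qu.
  by case/negP: ur; rewrite -[u]mulr1 -(expr0 ('X - r%:P)) -Qu.
pose v := P * u *+ m.+1 + ('X - r%:P) * wronskian u P.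
have Wv : wronskian P Q = - v * ('X - r%:P) ^+ m.
  rewrite wronskianN Qu wronskian_mulXsubC /v mulNr.
  by rewrite [u * P]mulrC.
have vr : v.[r] = P.[r] * u.[r] *+ m.+1.
  by rewrite /v hornerD hornerM hornerXsubC subrr mul0r addr0 hornerMn hornerM.
move: v Wv vr => v Wv vr.
pose A := C *: (u ^+ 4 * ('X - r%:P) ^+ (m.*2 + 4)) - v ^+ 2.
have : 0 <= A.[r].
  apply: (@poly_ge0_dense A (('X - r%:P) ^+ m)) => [|x].
    by rewrite expf_neq0 // polyXsubC_eq0.
  have := hW x; rewrite Wv Qu /A -subr_ge0.
  rewrite !(hornerXsubC, hornerD, hornerN, hornerZ, hornerM, horner_exp).
  congr (_ <= _); rewrite -muln2 exprD exprM [_ ^+ m.+1]exprS.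
  by move: ((x - r) ^+ m) u.[x] v.[x] => y ux vx; ring.
rewrite /A !(hornerXsubC, hornerD, hornerN, hornerZ, hornerM, horner_exp).
rewrite subrr addn4 [0 ^+ _]exprS mul0r !mulr0 add0r vr oppr_ge0.
move=> /(fun h => le_anti (introT andP (conj h (sqr_ge0 _)))) /eqP.
by rewrite sqrf_eq0 mulrn_eq0 mulf_eq0 -!rootE (negPf ur) orbF.
Qed.

(** The common roots of [P] and [Q] are divided out one by one, after which [Q]
    has no real root and the mean value theorem applies. *)
Theorem bounded_slope_lipschitz P Q C a b :
    (forall x, (wronskian P Q).[x] ^+ 2 <= C * Q.[x] ^+ 4) ->
  (P.[a] * Q.[b] - P.[b] * Q.[a]) ^+ 2
    <= C * (b - a) ^+ 2 * (Q.[a] * Q.[b]) ^+ 2.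
Proof.
wlog ab : a b / a < b => [hw|] hW.
  have [|ba|->] := ltgtP a b; first by move=> /hw; exact.
    by rewrite -opprB sqrrN -[b - a]opprB sqrrN [Q.[a] * _]mulrC; exact: hw.
  by rewrite !subrr expr0n /= mulr0 mul0r.
have [n] := ubnP (size Q); elim: n => // n IHn in P Q hW *; rewrite ltnS => sQ.
have [->|Q0] := eqVneq Q 0.
  by rewrite !horner0 !mulr0 subrr !expr0n /= mulr0.
have [[r]|nr] := boolp.pselect (exists r, root Q r).
  move=> Qr; have Pr := root_of_bounded_slope Q0 hW Qr.
  have /factor_theorem[Q1 Q1E] := Qr; have /factor_theorem[P1 P1E] := Pr.
  have Q10 : Q1 != 0 by apply: contraNneq Q0 => Q10; rewrite Q1E Q10 mul0r.
  have hW1 x : (wronskian P1 Q1).[x] ^+ 2 <= C * Q1.[x] ^+ 4.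
    pose A := C *: Q1 ^+ 4 - wronskian P1 Q1 ^+ 2.
    have /(_ x) : forall y, 0 <= A.[y].
      apply: (@poly_ge0_dense A (('X - r%:P) ^+ 2)) => [|y].
        by rewrite expf_neq0 // polyXsubC_eq0.
      have := hW y; rewrite P1E Q1E wronskian_mulr -subr_ge0 /A.
      rewrite !(hornerXsubC, hornerD, hornerN, hornerZ, hornerM, horner_exp).
      by congr (_ <= _); ring.
    rewrite /A !(hornerD, hornerN, hornerZ, hornerM, horner_exp).
    by rewrite subr_ge0.
  have sQ1 : (size Q1 < n)%N.
    apply: leq_trans sQ.
    by rewrite Q1E size_Mmonic ?monicXsubC // size_XsubC addn2.
  have h := IHn P1 Q1 hW1 sQ1.
  rewrite P1E Q1E !hornerM !hornerXsubC.
  have := ler_wpM2r (sqr_ge0 ((a - r) * (b - r))) h.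
  by congr (_ <= _); ring.
have Qn0 x : Q.[x] != 0 by apply/negP => Qx; apply: nr; exists x.
(* S / Q is a multiple of P / Q minus the affine function which agrees with it
   at a and b. *)
pose k := P.[b] * Q.[a] - P.[a] * Q.[b].
pose l := Q.[a] * Q.[b].
pose S := (b - a) *: (l *: P - (P.[a] * Q.[b]) *: Q) - k *: (('X - a%:P) * Q).
have [||||x _] := @rational_rolle S Q a b => //.
- rewrite /S !(hornerXsubC, hornerD, hornerN, hornerZ, hornerM) /l; ring.
- rewrite /S !(hornerXsubC, hornerD, hornerN, hornerZ, hornerM) /l /k; ring.
have -> : wronskian S Q = ((b - a) * l) *: wronskian P Q - k *: Q ^+ 2.
  rewrite /wronskian /S !derivE -!mul_polyC.
  by ring.
move: (wronskian P Q) (hW x) => W Wle.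
rewrite !(hornerD, hornerN, hornerZ, horner_exp) => /subr0_eq Wx.
have := ler_wpM2l (sqr_ge0 ((b - a) * l)) Wle; rewrite -exprMn Wx => h.
have Q4 : 0 < Q.[x] ^+ 4 by rewrite lt0r expf_neq0 //= (exprM _ 2 2) sqr_ge0.
by rewrite -(ler_pM2r Q4); move: h; congr (_ <= _); rewrite /k /l; ring.
Qed.

End BoundedSlope.

(** * Linear differential systems over polynomials *)

Section PowerSeriesUniqueness.
Variable K : numFieldType.

(** Uniqueness for a linear system, nonsingular at [0]: the system expresses the
    coefficient [k + 1] of each [U i] through the coefficients of order at
    most [k] of all of them. *)
Lemma linear_ode_eq0 n (Q : {poly K}) (U : 'I_n -> {poly K})
    (A : 'I_n -> 'I_n -> {poly K}) : Q.[0] != 0 -> (forall i, (U i).[0] = 0) ->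
    (forall i, Q * (U i)^`() = \sum_j A i j * U j) ->
  forall i, U i = 0.
Proof.
move=> Q0 U0 ode; suff h k j : (j <= k)%N -> forall i, (U i)`_j = 0.
  by move=> i; apply/polyP => k; rewrite coef0 (h k k).
elim: k j => [|k IHk] j.
  by rewrite leqn0 => /eqP-> i; rewrite -horner_coef0 U0.
rewrite leq_eqVlt ltnS => /predU1P[->|] i; last exact: IHk.
have /(congr1 (fun P : {poly K} => P`_k)) := ode i.
rewrite coef_sum big1 => [|l _]; last first.
  by rewrite coefMr big1 // => m _; rewrite IHk ?mulr0 // -ltnS.
rewrite coefM big_ord_recl big1 /= => [|m _]; last first.
  rewrite coef_deriv IHk ?mul0rn ?mulr0 //=.
  by rewrite /bump /= add1n subnSK // leq_subr.
rewrite addr0 subn0 coef_deriv -horner_coef0 => /eqP.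
by rewrite mulf_eq0 (negPf Q0) mulrn_eq0 /= => /eqP.
Qed.

End PowerSeriesUniqueness.

(** * Restriction of multivariate polynomials to lines *)

(** Restriction to the parametrized line [t |-> x + t d]; a notation rather than
    a constant, so that it inherits the ring morphism structure of [mmap]. *)
Notation line x d := (mmap polyC (fun i => (x i)%:P + d i *: 'X)).

Section Lines.
Variables (K : comNzRingType) (n : nat).
Implicit Types (p q : {mpoly K[n]}) (x d : 'I_n -> K).

(** Induction along the ring operations, which suits statements about ring
    morphisms and derivations better than induction on monomials. *)
Lemma mpoly_alg_ind (P : {mpoly K[n]} -> Prop) :
    (forall c, P c%:MP) -> (forall i, P 'X_i) ->
    (forall p q, P p -> P q -> P (p + q)) ->
    (forall p q, P p -> P q -> P (p * q)) ->
  forall p, P p.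
Proof.
move=> PC PX PD PM; apply: mpolyind => [|c m p _ _ Pp].
  by rewrite -mpolyC0.
apply: (PD) => //; rewrite -mul_mpolyC; apply: (PM) => //.
rewrite mpolyXE_id; apply: big_ind => [|//|i _]; first by rewrite -mpolyC1.
by elim: (m i) => [|k IHk]; rewrite ?expr0 ?exprS -?mpolyC1 //; apply: PM.
Qed.

Lemma line_horner x d p t :
  (line x d p).[t] = p.@[fun i => x i + d i * t].
Proof.
elim/mpoly_alg_ind: p => [c|i|p q IHp IHq|p q IHp IHq].
- by rewrite mmapC mevalC hornerC.
- by rewrite mmapX mmap1U mevalXU hornerD hornerC hornerZ hornerX.
- by rewrite !rmorphD hornerD IHp IHq.
- by rewrite !rmorphM hornerM IHp IHq.
Qed.

Lemma mderivXU i j : 'X_j^`M(i) = (j == i)%:R :> {mpoly K[n]}.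
Proof.
rewrite mderivX mnm1E; case: eqP => [->|_]; last by rewrite scale0r.
by rewrite scale1r -[LHS]/('X_[_]) (_ : (U_(i) - U_(i))%MM = 0%MM) ?mpolyX0 //;
   apply/mnmP => k; rewrite mnmBE subnn mnm0E.
Qed.

Lemma deriv_line x d p :
  (line x d p)^`() = \sum_i d i *: line x d p^`M(i).
Proof.
elim/mpoly_alg_ind: p => [c|i|p q IHp IHq|p q IHp IHq].
- by rewrite mmapC derivC big1 // => i _; rewrite mderivC raddf0 scaler0.
- rewrite mmapX mmap1U derivD derivC add0r derivZ derivX (bigD1 i) //=.
  rewrite mderivXU eqxx rmorph1 big1 ?addr0 // => j ji.
  by rewrite mderivXU eq_sym (negPf ji) raddf0 scaler0.
- rewrite rmorphD derivD IHp IHq -big_split; apply: eq_bigr => i _.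
  by rewrite mderivD rmorphD scalerDr.
- rewrite rmorphM derivM IHp IHq mulr_suml mulr_sumr -big_split.
  apply: eq_bigr => i _; rewrite mderivM rmorphD !rmorphM scalerDr.
  by rewrite scalerAl scalerAr.
Qed.

Lemma meval0_mcoeff p : p.@[fun=> 0] = p@_0%MM.
Proof.
elim/mpoly_alg_ind: p => [c|i|p q IHp IHq|p q IHp IHq].
- by rewrite mevalC mcoeffC eqxx mulr1.
- by rewrite mevalXU mcoeffX mnm1_eq0.
- by rewrite mevalD mcoeffD IHp IHq.
- by rewrite mevalM rmorphM IHp IHq.
Qed.

End Lines.

Section Vanishing.
Variables (K : numFieldType) (n : nat).
Implicit Types (p q : {mpoly K[n]}).

Lemma meval_mderiv_eq0 p i : (forall x, p.@[x] = 0) ->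
  forall x, p^`M(i).@[x] = 0.
Proof.
move=> p0 x; pose d j : K := (j == i)%:R.
pose l := line x d p.
have l0 : l = 0.
  pose rs := [seq k%:R : K | k <- iota 0 (size l)].
  apply: (@roots_geq_poly_eq0 _ l rs); last by rewrite size_map size_iota.
    by apply/allP => t _; rewrite /root line_horner p0.
  by rewrite map_inj_uniq ?iota_uniq //; apply: mulrIn; rewrite oner_eq0.
have := deriv_line x d p; rewrite -/l l0 derivC (bigD1 i) //= big1 ?addr0.
  rewrite /d eqxx scale1r => /(congr1 (horner^~ 0)); rewrite horner0 line_horner.
  by move=> /esym <-; apply: meval_eq => j; rewrite mulr0 addr0.
by move=> j ji; rewrite /d (negPf ji) scale0r.
Qed.

(** Polynomial identities may be checked pointwise.  By the chain rule all
    partial derivatives of a polynomial function that vanishes everywhere vanish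
    everywhere as well, and up to factorials their values at [0] are the
    coefficients. *)
Lemma meval_inj p q : (forall x, p.@[x] = q.@[x]) -> p = q.
Proof.
move=> pq; apply/eqP; rewrite -subr_eq0; apply/eqP.
have {pq} : forall x, (p - q).@[x] = 0 by move=> x; rewrite mevalB pq subrr.
move: (p - q) => {q}p p0; apply/mpolyP => m; rewrite mcoeff0.
elim: {m}(mdeg m) {-2}m (erefl (mdeg m)) p p0 => [|k IHk] m mk p p0.
  by move/eqP: mk; rewrite mdeg_eq0 => /eqP->; rewrite -meval0_mcoeff.
have [i mi] : exists i, m i != 0%N.
  have [/existsP //|/existsPn m0] := boolP [exists i, m i != 0%N].
  suff m00 : m = 0%MM by move: mk; rewrite m00 mdeg0.
  by apply/mnmP => i; rewrite mnm0E; apply/eqP/negPn.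
have mE : (m - U_(i) + U_(i))%MM = m by rewrite submK // lep1mP.
have mk' : mdeg (m - U_(i))%MM = k.
  by apply/eqP; rewrite -eqSS -mk -{2}mE mdegD mdeg1 addn1.
have := IHk (m - U_(i))%MM mk' p^`M(i) (meval_mderiv_eq0 i p0).
by rewrite mcoeff_deriv mE => /eqP; rewrite mulrn_eq0 => /eqP.
Qed.

End Vanishing.

(** * The eikonal equation with cleared denominators *)

Section EikonalPolynomials.
Variables (R : rcfType) (n : nat).
Implicit Types (x y d : 'I_n -> R).

(** By Lagrange's identity the difference of the two sides is half of
    [\sum_i \sum_j (a i * b j - a j * b i) ^+ 2]. *)
Lemma cauchy_schwarz_sum (a b : 'I_n -> R) :
  (\sum_i a i * b i) ^+ 2 <= (\sum_i a i ^+ 2) * (\sum_i b i ^+ 2).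
Proof.
have : 0 <= \sum_i \sum_j (a i * b j - a j * b i) ^+ 2.
  by apply: sumr_ge0 => i _; apply: sumr_ge0 => j _; rewrite sqr_ge0.
pose s i j := a i ^+ 2 * b j ^+ 2 - (a i * b i) * (a j * b j).
have -> : \sum_i \sum_j (a i * b j - a j * b i) ^+ 2
    = \sum_i \sum_j s i j + \sum_i \sum_j s j i.
  rewrite -big_split; apply: eq_bigr => i _; rewrite -big_split.
  by apply: eq_bigr => j _; rewrite /s /=; ring.
rewrite [X in _ + X]exchange_big -mulr2n pmulrn_lge0 //.
rewrite (eq_bigr (fun i => a i ^+ 2 * (\sum_j b j ^+ 2)
  - a i * b i * (\sum_j a j * b j))); last first.
  by move=> i _; rewrite sumrB !mulr_sumr.
by rewrite sumrB -!mulr_suml subr_ge0 expr2.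
Qed.

Variables (p q : {mpoly R[n]}) (c : R).

(** The numerators of [grad (p / q)] over the denominator [q ^+ 2]. *)
Definition grad_num i : {mpoly R[n]} := p^`M(i) * q - p * q^`M(i).

Hypothesis eikE : \sum_i grad_num i ^+ 2 = c *: q ^+ 4.

(** The numerators of the Hessian of [p / q] over the denominator [q ^+ 3]. *)
Definition hess_num i j : {mpoly R[n]} :=
  (grad_num i)^`M(j) * q - grad_num i * q^`M(j) *+ 2.

Lemma hess_numC i j : hess_num i j = hess_num j i.
Proof.
rewrite /hess_num /grad_num !mderivB !mderivM (mderiv_comm i j).
by rewrite (mderiv_comm i j q); ring.
Qed.

(** The Hessian kills the gradient: by symmetry this is half the derivative of
    the constant [|grad f|^2]. *)
Lemma hess_grad_eq0 i : \sum_j grad_num j * hess_num i j = 0.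
Proof.
have dE : (\sum_j grad_num j ^+ 2)^`M(i) = c *: (q ^+ 3 * q^`M(i) *+ 4).
  by rewrite eikE mderivZ !exprS expr0 mulr1 !mderivM; congr (_ *: _); ring.
have two j : (grad_num j * hess_num i j) *+ 2
    = (grad_num j ^+ 2)^`M(i) * q - grad_num j ^+ 2 * (q^`M(i) *+ 4).
  by rewrite hess_numC expr2 mderivM /hess_num; ring.
have : (2%:R : R) *: (\sum_j grad_num j * hess_num i j) = 0.
  rewrite scaler_nat -sumrMnl (eq_bigr _ (fun j _ => two j)).
  rewrite sumrB -!mulr_suml -raddf_sum /= dE eikE -!scalerAl -scalerBr.
  by rewrite [X in _ *: X](_ : _ = 0) ?scaler0 //; ring.
by move=> /eqP; rewrite scaler_eq0 pnatr_eq0 => /eqP.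
Qed.

(** The speed of [p / q] on the segment from [x] to [y] is the scalar product of
    [y - x] with the gradient, which Cauchy-Schwarz bounds. *)
Lemma eikonal_lipschitz x y :
  (p.@[x] * q.@[y] - p.@[y] * q.@[x]) ^+ 2
    <= c * (\sum_i (y i - x i) ^+ 2) * (q.@[x] * q.@[y]) ^+ 2.
Proof.
pose d i := y i - x i.
have := @bounded_slope_lipschitz _ (line x d p) (line x d q)
  (c * \sum_i d i ^+ 2) 0 1.
have l0 r : (line x d r).[0] = r.@[x].
  by rewrite line_horner; apply: meval_eq => i; rewrite mulr0 addr0.
have l1 r : (line x d r).[1] = r.@[y].
  by rewrite line_horner; apply: meval_eq => i; rewrite mulr1 addrC subrK.
rewrite !l0 !l1 subr0 expr1n mulr1; apply=> t.
have -> : wronskian (line x d p) (line x d q)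
    = \sum_i d i *: line x d (grad_num i).
  rewrite /wronskian !deriv_line mulr_suml mulr_sumr -sumrB.
  apply: eq_bigr => i _; rewrite rmorphB !rmorphM scalerBr.
  by rewrite scalerAl scalerAr.
rewrite horner_sum.
under eq_bigr => i _ do rewrite hornerZ.
apply: le_trans (cauchy_schwarz_sum _ _) _.
rewrite [X in _ <= X](_ : _ = (\sum_i d i ^+ 2) * (c * (line x d q).[t] ^+ 4)).
  rewrite -!horner_exp -rmorphXn -hornerZ.
  have -> : c *: line x d (q ^+ 4) = line x d (c *: q ^+ 4).
    by rewrite mmapZ mul_polyC.
  rewrite -eikE rmorph_sum horner_sum.
  by under [X in _ <= _ * X]eq_bigr => i _ do rewrite rmorphXn horner_exp.
by ring.
Qed.

Section Characteristic.
Variable x : 'I_n -> R.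
Hypothesis qx : q.@[x] != 0.
Let v i := (grad_num i).@[x] / q.@[x] ^+ 2.
Let Q := line x v q.

Lemma line0 r : (line x v r).[0] = r.@[x].
Proof. by rewrite line_horner; apply: meval_eq => i; rewrite mulr0 addr0. Qed.

Lemma sum_sqr_grad : \sum_i v i ^+ 2 = c.
Proof.
have q4 : q.@[x] ^+ 4 != 0 by rewrite expf_neq0.
apply: (mulIf q4); rewrite -[X in _ = c * X](rmorphXn (meval x)) -mevalZ -eikE.
rewrite rmorph_sum mulr_suml; apply: eq_bigr => i _; rewrite rmorphXn.
by rewrite /v /=; field.
Qed.

(** Let [u(t) = grad f (x + t v) - v].  Its derivative is the Hessian applied to
    [v], that is to [- u], since the Hessian kills the gradient; so [u] solves a
    linear system with [u(0) = 0].  Below, [U] is [u] multiplied by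
    [Q ^+ 2], which accounts for the diagonal term of [A]. *)
Lemma grad_characteristic i : line x v (grad_num i) = v i *: Q ^+ 2.
Proof.
pose g j := line x v (grad_num j).
pose h i j := line x v (hess_num i j).
pose U j := g j - v j *: Q ^+ 2.
pose A i j := (i == j)%:R * (Q ^+ 2 * Q^`() *+ 2) - h i j.
apply/subr0_eq; apply: (@linear_ode_eq0 _ _ (Q ^+ 3) U A) => {i} [|i|i].
- by rewrite horner_exp line0 expf_neq0.
- by rewrite hornerD hornerN hornerZ horner_exp !line0 /v divfK ?subrr ?expf_neq0.
have hv : \sum_j v j *: h i j = (g i)^`() * Q - g i * Q^`() *+ 2.
  rewrite !deriv_line mulr_suml mulr_sumr -sumrMnl -sumrB.
  apply: eq_bigr => j _; rewrite /h /hess_num rmorphB rmorphMn !rmorphM.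
  by rewrite scalerBr scalerAl -!scalerMnr -scalerAr.
have hg : \sum_j h i j * g j = 0.
  rewrite -[RHS](rmorph0 (line x v)) -(hess_grad_eq0 i) rmorph_sum.
  by apply: eq_bigr => j _; rewrite /= rmorphM mulrC.
have -> : \sum_j A i j * U j
    = Q ^+ 2 * Q^`() *+ 2 * U i + Q ^+ 2 * \sum_j v j *: h i j.
  rewrite (eq_bigr (fun j => (i == j)%:R * (Q ^+ 2 * Q^`() *+ 2) * U j
    + Q ^+ 2 * (v j *: h i j) - h i j * g j)); last first.
    by move=> j _; rewrite /A /U -!mul_polyC; ring.
  rewrite sumrB hg subr0 big_split /= mulr_sumr; congr (_ + _).
  rewrite (bigD1 i) //= eqxx mul1r big1 ?addr0 // => j.
  by rewrite eq_sym => /negPf->; rewrite !mul0r.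
by rewrite hv /U derivB derivZ expr2 derivM -!mul_polyC; ring.
Qed.

(** Along the characteristic [f] has the constant slope [v . v = c]. *)
Lemma fun_characteristic :
  line x v p = ((p.@[x] / q.@[x])%:P + c *: 'X) * Q.
Proof.
pose L := (p.@[x] / q.@[x])%:P + c *: 'X.
apply/subr0_eq.
apply: (@linear_ode_eq0 _ 1 Q (fun=> line x v p - L * Q)
  (fun _ _ => Q^`()) _ _ _ ord0).
- by rewrite line0.
- move=> _; rewrite hornerD hornerN hornerM !line0 /L.
  by rewrite hornerD hornerC hornerZ hornerX mulr0 addr0 divfK ?subrr.
move=> _; rewrite big_ord1.
have W : (line x v p)^`() * Q - line x v p * Q^`() = c *: Q ^+ 2.
  rewrite !deriv_line mulr_suml mulr_sumr -sumrB -sum_sqr_grad scaler_suml.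
  apply: eq_bigr => i _; rewrite [v i ^+ 2]expr2 -[RHS]scalerA.
  rewrite -grad_characteristic /grad_num.
  by rewrite rmorphB !rmorphM scalerBr scalerAl scalerAr.
have -> : (line x v p - L * Q)^`() = (line x v p)^`() - c%:P * Q - L * Q^`().
  rewrite derivB derivM /L derivD derivC derivZ derivX.
  by rewrite add0r alg_polyC opprD addrA.
rewrite -mul_polyC in W.
by apply/subr0_eq; rewrite -(subrr (c%:P * Q ^+ 2)) -{1}W; ring.
Qed.

End Characteristic.

(** The whole graph is determined by one characteristic [x + t v], because the
    Lipschitz bound between its points and a given [y] becomes sharp as [t]
    tends to both infinities. *)
Theorem eikonal_polynomial_affine : q != 0 ->
  exists (a : 'I_n -> R) (b : R), p = (\sum_i a i *: 'X_i + b%:MP) * q.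
Proof.
move=> q0.
have [x qx] : exists x, q.@[x] != 0.
  have [//|nx] := boolp.pselect (exists x, q.@[x] != 0).
  case/eqP: q0; apply: meval_inj => x; rewrite meval0; apply/eqP/negPn/negP => qx.
  by apply: nx; exists x.
pose v i := (grad_num i).@[x] / q.@[x] ^+ 2.
pose f0 := p.@[x] / q.@[x].
exists v, (f0 - \sum_i v i * x i); apply: meval_inj => y.
rewrite mevalM mevalD mevalC rmorph_sum /=.
under eq_bigr => i _ do rewrite mevalZ mevalXU.
pose D := \sum_i (y i - x i) ^+ 2.
pose s := \sum_i v i * (y i - x i).
have -> : \sum_i v i * y i + (f0 - \sum_i v i * x i) = f0 + s.
  by rewrite addrCA -sumrB; congr (_ + _); apply: eq_bigr => i _; rewrite mulrBr.
set k := q.@[y].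
pose e := p.@[y] - f0 * k.
(* The Lipschitz bound between x + t v and y; the terms in t ^+ 2 cancel. *)
have key t : e ^+ 2 - c * k ^+ 2 * D <= t * (c * k * (e - k * s) *+ 2).
  have /(_ t) : forall t, 0 <= ((c * k ^+ 2 * D - e ^+ 2)%:P
      + (c * k * (e - k * s) *+ 2) *: 'X).[t].
    apply: (@poly_ge0_dense _ _ (line x v q)) => [|{}t].
      by apply: contraNneq qx => l0; rewrite -line0 l0 horner0.
    have := eikonal_lipschitz (fun i => x i + v i * t) y.
    rewrite -!line_horner (fun_characteristic qx) -/v hornerM -subr_ge0.
    rewrite !(hornerD, hornerC, hornerZ, hornerX) -/f0 -/k.
    have -> : \sum_i (y i - (x i + v i * t)) ^+ 2 = D - s * t *+ 2 + c * t ^+ 2.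
      rewrite -(sum_sqr_grad qx) /D /s !mulr_suml -sumrMnl -sumrB -big_split.
      by apply: eq_bigr => i _; rewrite /= /v; ring.
    by congr (_ <= _); rewrite /e; ring.
  rewrite hornerD hornerC hornerZ hornerX => At; rewrite -subr_ge0; move: At.
  by congr (_ <= _); ring.
have slope0 : c * k * (e - k * s) = 0.
  apply/eqP/negPn/negP => b0.
  (* at this t the affine function of key would be -1 *)
  have := key ((e ^+ 2 - c * k ^+ 2 * D - 1) / (c * k * (e - k * s) *+ 2)).
  by rewrite divfK ?mulrn_eq0 // lerDl oppr_ge0 ler10.
suff eks : e = k * s by rewrite -[LHS](subrK (f0 * k)) -/e eks; ring.
have := key 0; rewrite mul0r subr_le0 => e2.
have [k0|k0] := eqVneq k 0.
  move: e2; rewrite k0 expr0n mulr0 mul0r mul0r => e2; apply/eqP.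
  by rewrite -sqrf_eq0 eq_le e2 sqr_ge0.
have [c00|cn0] := eqVneq c 0; last first.
  apply/subr0_eq; apply/eqP; move/eqP: slope0.
  by rewrite mulf_eq0 mulf_eq0 (negPf k0) (negPf cn0).
have -> : s = 0.
  apply: big1 => i _; have := sum_sqr_grad qx; rewrite c00 => /eqP.
  rewrite psumr_eq0 => [/allP /(_ i)|j _]; last exact: sqr_ge0.
  rewrite mem_index_enum sqrf_eq0 => /(_ isT) /eqP.
  by rewrite -/(v i) => ->; rewrite mul0r.
move: e2; rewrite c00 !mul0r mulr0 => e2; apply/eqP.
by rewrite -sqrf_eq0 eq_le e2 sqr_ge0.
Qed.

End EikonalPolynomials.

(** * Rational solutions *)

(** The factor is the quotient of two coefficients, hence already lies in [K];
    this turns the complex constant of the equation into a real one. *)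
Lemma proportional_descent (K L : fieldType) n (phi : {rmorphism K -> L})
    (N Q : {mpoly K[n]}) (c : L) : Q != 0 ->
  map_mpoly phi N = c *: map_mpoly phi Q -> exists k : K, N = k *: Q.
Proof.
move=> Q0 NQ; have coefE m : phi N@_m = c * phi Q@_m.
  by have /(congr1 (mcoeff m)) := NQ; rewrite mcoeffZ !mcoeff_map_mpoly.
exists (N@_(mlead Q) / Q@_(mlead Q)).
apply/mpolyP => m; apply: (fmorph_inj phi).
by rewrite mcoeffZ rmorphM fmorph_div !coefE mulfK // fmorph_eq0 mleadc_eq0.
Qed.

Lemma eikonal_numerators (R : realType) (c : R[i]) (f : ratfun R 3) :
    ratfun_complex (eikonal f) = ratfunC 3 c ->
  exists k : R, \sum_i grad_num (fnum f) (fden f) i ^+ 2 = k *: fden f ^+ 4.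
Proof.
set q := fden f; set N := \sum_i _ => hf; have q0 : q != 0 := fden_neq0 f.
have q4 : q ^+ 4 != 0 by rewrite expf_neq0.
have eikE : eikonal f = tofrac N / tofrac (q ^+ 4).
  rewrite /eikonal rmorph_sum mulr_suml; apply: eq_bigr => i _.
  by rewrite /rderiv -/q -/(grad_num _ _ i) expr_div_n -!rmorphXn -exprM.
apply: (@proportional_descent _ _ _ (real_complex R) _ _ c q4).
move: hf; rewrite /ratfun_complex eikE ratfun_map_frac // /ratfunC.
rewrite -[X in _ = X]divr1 -tofrac1 => /frac_eqP.
by rewrite map_mpoly_eq0 oner_neq0 mulr1 mul_mpolyC => /(_ q4 isT).
Qed.

Theorem corollary1p3 (R : realType) (c : R[i]) (f : ratfun R 3)
    (hf : ratfun_complex (eikonal f) = ratfunC 3 (c ^+ 2)) :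
  is_affine f.
Proof.
have [k eikE] := eikonal_numerators hf.
have [a [b pE]] := eikonal_polynomial_affine eikE (fden_neq0 f).
exists a, b; rewrite {1}(fracE f) pE rmorphM mulfK // tofrac_eq0.
exact: fden_neq0.
Qed.
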